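(* Let $\mathcal M$ be a class of distributions of random closed sets in a separable Banach space $E$. For $\alpha\in[0,1]$, the function $V_\alpha\colon E\times\mathfrak U\to\mathbb R$, $V_\alpha(u,Y)=\mathbf 1_Y(u)-\alpha$, is a strict selective $\mathcal M$-identification function for $Q_\alpha^=$. Moreover, $V_\alpha$ is oriented in the sense that for all $u\in E$ and all $F\in\mathcal M$ $$\bar V_\alpha(u,F)\begin{cases}>0,&u\in Q_\alpha^>(F),\\=0,&u\in Q_\alpha^=(F),\\<0,&u\notin Q_\alpha(F).\end{cases}$$
   Context: $E$ is a separable Banach space with its Borel $\sigma$-algebra, $\mathfrak U$ the family of closed subsets of $E$, $(\Omega,\mathfrak F,\mathbf P)$ a complete atomless probability space. A random closed set is a map $\mathbf Y\colon\Omega\to\mathfrak U$ with $\{\omega:\mathbf Y(\omega)\cap K\ne\emptyset\}\in\mathfrak F$ for all compact $K\subseteq E$; its distribution $F_{\mathbf Y}$ is identified with the capacity functional $F_{\mathbf Y}(K)=\mathbf P(\mathbf Y\cap K\neq\emptyset)$, $K$ compact. Coverage function: $p_{\mathbf Y}(u)=F_{\mathbf Y}(\{u\})=\mathbf P(u\in\mathbf Y)$. For $F=F_{\mathbf Y}$: $Q_\alpha(F)=\{u\in E:p_{\mathbf Y}(u)\ge\alpha\}$ (Vorob'ev $\alpha$-quantile), $Q_\alpha^>(F)=\{u:p_{\mathbf Y}(u)>\alpha\}$, $Q_\alpha^=(F)=\{u:p_{\mathbf Y}(u)=\alpha\}$. $\bar V_\alpha(u,F)=\mathbf E_F[V_\alpha(u,\mathbf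 Y)]$ where $\mathbf Y$ has distribution $F$. $V$ is a strict selective $\mathcal M$-identification function for $T\colon\mathcal M\to2^E$ if for all $u\in E$, $F\in\mathcal M$: $\bar V(u,F)=0$ iff $u\in T(F)$. *)

(* Defs.v *)
From HB Require Import structures.
From mathcomp Require Import all_boot all_order all_algebra.
From mathcomp Require Import all_classical all_reals all_analysis.
From mathcomp Require Import measurable_realfun.
Import Order.TTheory GRing.Theory Num.Theory.
Import numFieldNormedType.Exports.

Set Implicit Arguments.
Unset Strict Implicit.
Unset Printing Implicit Defensive.

Local Open Scope classical_set_scope.
Local Open Scope ring_scope.

Definition separable (E : topologicalType) : Prop :=
  exists2 D : set E, countable D & dense D.

Definition atomless d (Omega : measurableType d) (R : realType)
    (P : probability Omega R) : Prop :=
  forall A, measurable A -> (0 < P A)%E ->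
    exists B, [/\ measurable B, B `<=` A & (0 < P B < P A)%E].

Record closedSet (E : topologicalType) := ClosedSet {
  closedSet_set :> set E;
  closedSetP : closed closedSet_set }.

Record compactSet (E : topologicalType) := CompactSet {
  compactSet_set :> set E;
  compactSetP : compact compactSet_set }.

Definition compactSet1 (E : topologicalType) (u : E) : compactSet E :=
  CompactSet (compact_set1 (x := u)).

Section random_closed_sets.
Context (d : measure_display) (Omega : measurableType d) (R : realType).
Context (P : probability Omega R) (E : completeNormedModType R).

Record randomClosedSet := RandomClosedSet {
  rcs_fun :> Omega -> closedSet E;
  rcs_measurable : forall K : compactSet E,
    measurable [set w | rcs_fun w `&` K !=set0] }.

Definition capacity (Y : randomClosedSet) (K : compactSet E) : R :=
  fine (P [set w | Y w `&` K !=set0]).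

Record rcsDistribution := RcsDistribution {
  rcsD_fun :> compactSet E -> R;
  rcsDP : exists Y : randomClosedSet, capacity Y = rcsD_fun }.

Definition coverage (F : rcsDistribution) (u : E) : R := F (compactSet1 u).

(* Vorob'ev quantile *)
Definition Qge (alpha : R) (F : rcsDistribution) : set E :=
  [set u | alpha <= coverage F u].

Definition Qgt (alpha : R) (F : rcsDistribution) : set E :=
  [set u | alpha < coverage F u].

Definition Qeq (alpha : R) (F : rcsDistribution) : set E :=
  [set u | coverage F u = alpha].

Definition rcs_of (F : rcsDistribution) : randomClosedSet :=
  projT1 (cid (rcsDP F)).

Lemma rcs_ofP (F : rcsDistribution) : capacity (rcs_of F) = F.
Proof. exact: (projT2 (cid (rcsDP F))). Qed.

(* The value does not depend on the representative rcs_of F of the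
   distribution F: see Vbar_rcs and measurable_Valpha below. *)
Definition Vbar (V : E -> closedSet E -> R) (u : E) (F : rcsDistribution) :
  \bar R := 'E_P[fun w => V u (rcs_of F w)].

Definition strict_selective_identification (M : set rcsDistribution)
    (V : E -> closedSet E -> R) (T : rcsDistribution -> set E) : Prop :=
  forall u F, M F -> Vbar V u F = 0%E <-> u \in T F.

Definition Valpha (alpha : R) (u : E) (Y : closedSet E) : R := \1_Y u - alpha.

End random_closed_sets.

Section Vbar_rcs.
Context (d : measure_display) (Omega : measurableType d) (R : realType).
Context (P : probability Omega R) (E : completeNormedModType R).

HB.instance Definition _ := gen_eqMixin (closedSet E).
HB.instance Definition _ := gen_choiceMixin (closedSet E).
HB.instance Definition _ := isPointed.Build (closedSet E) (ClosedSet closed0).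

(* The complements of the hitting events {Y | Y meets K}, K compact: they form
   a pi-system generating the sigma-algebra that makes random closed sets
   measurable maps. *)
Definition missing : set (set (closedSet E)) :=
  [set [set Y : closedSet E | Y `&` K = set0] | K in @compact E].

Let cE := g_sigma_algebraType missing.

Lemma missing_setI : setI_closed missing.
Proof.
move=> _ _ [K cK <-] [L cL <-]; exists (K `|` L); first exact: compactU.
apply/seteqP; split => Y /=; rewrite setIUr; first by rewrite setU_eq0.
by case=> -> ->; rewrite setU0.
Qed.

Lemma missingT : missing setT.
Proof.
exists set0; first exact: compact0.
by apply/seteqP; split => // Y _ /=; rewrite setI0.
Qed.

Lemma rcs_missing (Y : randomClosedSet Omega E) (K : compactSet E) :
  [set w | Y w `&` K = set0] = ~` [set w | Y w `&` K !=set0].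
Proof.
by apply/seteqP; split => w /=; rewrite -nonemptyPn.
Qed.

Lemma measurable_rcs (Y : randomClosedSet Omega E) :
  measurable_fun setT (Y : Omega -> cE).
Proof.
apply: (measurability (aT := Omega) (rT := cE) missing) => //.
move=> _ [_ [K cK <-] <-]; rewrite setTI.
rewrite -[X in measurable X]/([set w | Y w `&` (CompactSet cK) = set0]).
by rewrite rcs_missing; apply: measurableC; exact: rcs_measurable.
Qed.

Definition rcs_mfun (Y : randomClosedSet Omega E) : {mfun Omega >-> cE} :=
  HB.pack (Y : Omega -> cE) (isMeasurableFun.Build _ _ _ _ _ (measurable_rcs Y)).

Lemma capacity_law (Y Z : randomClosedSet Omega E) (A : set cE) :
  capacity P Y = capacity P Z -> measurable A ->
  pushforward P (rcs_mfun Y) A = pushforward P (rcs_mfun Z) A.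
Proof.
move=> YZ; apply: (measure_unique (T := cE) missing (fun=> setT) _ _ _ _
  (pushforward P (rcs_mfun Y)) (pushforward P (rcs_mfun Z))) => //.
- exact: missing_setI.
- by move=> _; exact: missingT.
- by rewrite bigcup_const.
- move=> _ [K cK <-]; rewrite /pushforward/=.
  have PE (X : randomClosedSet Omega E) :
      P [set w | X w `&` K = set0] =
      (1 - (capacity P X (CompactSet cK))%:E)%E.
    rewrite -/([set w | X w `&` (CompactSet cK) = set0]).
    rewrite rcs_missing probability_setC; last exact: rcs_measurable.
    rewrite /capacity fineK//.
    by apply: fin_num_measure; exact: rcs_measurable.
  by have := PE Y; rewrite YZ -(PE Z).
- by move=> _; rewrite [X in (X < _)%E](_ : _ = P setT)// probability_setT ltry.
Qed.

Lemma Vbar_rcs (V : E -> closedSet E -> R) (u : E) (F : rcsDistribution P E)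
    (Y : randomClosedSet Omega E) :
  measurable_fun setT (V u : cE -> R) -> capacity P Y = F ->
  Vbar V u F = 'E_P[fun w => V u (Y w)]%E.
Proof.
move=> mV YF; rewrite /Vbar; set Z := rcs_of F.
have ZY : capacity P Z = capacity P Y by rewrite YF; exact: rcs_ofP.
have ge0_eq (f : cE -> \bar R) :
    measurable_fun (T := cE) (U := \bar R) setT f -> (forall y, 0 <= f y)%E ->
    (\int[P]_w f (Z w) = \int[P]_w f (Y w))%E.
  move=> mf f0.
  have push (X : randomClosedSet Omega E) :
      (\int[P]_w f (X w) = \int[pushforward P (rcs_mfun X)]_y f y)%E.
    by rewrite (ge0_integral_pushforward (measurable_rcs X)).
  rewrite !push; apply: eq_measure_integral => A mA _.
  exact: capacity_law.
pose f : cE -> \bar R := EFin \o V u.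
have mf : measurable_fun setT f by exact/measurable_EFinP.
rewrite unlock integralE [RHS]integralE.
rewrite (funepos_comp f Z) (funepos_comp f Y).
rewrite (funeneg_comp f Z) (funeneg_comp f Y).
congr (_ - _)%E; apply: ge0_eq => //.
- exact: measurable_funepos.
- exact: measurable_funeneg.
Qed.

Lemma measurable_Valpha (alpha : R) (u : E) :
  measurable_fun setT (Valpha alpha u : cE -> R).
Proof.
have mhit : @measurable _ cE [set Y : closedSet E | closedSet_set Y u].
  rewrite (_ : [set _ | _] = ~` [set Y : closedSet E | Y `&` [set u] = set0]).
    apply: measurableC; apply: sub_sigma_algebra.
    by exists [set u] => //; exact: compact_set1.
  apply/seteqP; split => Y /= => [Yu|].
    by apply/eqP/set0P; exists u.
  by move=> /eqP /set0P [x [Yx xu]]; rewrite -xu.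
apply: measurable_funB => //.
rewrite (_ : (fun Y : cE => _) = \1_([set Y : closedSet E | closedSet_set Y u] : set cE)).
  exact: measurable_indic.
by apply/funext => Y; rewrite !indicE; congr (_%:R); apply/idP/idP; rewrite !inE.
Qed.

End Vbar_rcs.

(* Main.v *)
Require Import Defs.
From HB Require Import structures.
From mathcomp Require Import all_boot all_order all_algebra.
From mathcomp Require Import all_classical all_reals all_analysis.
From mathcomp Require Import measurable_realfun.
Import Order.TTheory GRing.Theory Num.Theory.
Import numFieldNormedType.Exports.

Local Open Scope classical_set_scope.
Local Open Scope ring_scope.

(** The expectation of the indicator [\1_Y u] is the probability that [u] lies in [Y], which is the
    coverage function at [u]. By linearity, the expected identification function is
    [coverage F u - alpha] ([Vbar_Valpha]), and both identification and orientation are read off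
    from the sign of this real number. *)

Lemma Vbar_Valpha (R : realType) (E : completeNormedModType R)
  (d : measure_display) (Omega : measurableType d) (P : probability Omega R)
  (alpha : R) (u : E) (F : rcsDistribution P E) :
  Vbar (Valpha alpha) u F = (coverage F u - alpha)%:E.
Proof.
(* Hitting the singleton amounts to containing [u]; phrased as a hitting event, [A] is measurable by
   the definition of a random closed set. *)
pose A := [set w | rcs_of F w `&` compactSet1 u !=set0].
have mA : measurable A by exact: rcs_measurable.
have fA : P A \is a fin_num by exact: fin_num_measure.
have AE w : \1_(rcs_of F w) u = \1_A w :> R.
  rewrite !indicE; congr ((nat_of_bool _)%:R); apply/idP/idP; rewrite !inE.
    by move=> Yu; exists u.
  by case=> x [Yx /= <-].
have -> : coverage F u = fine (P A).
  (* [F] is the capacity of its chosen representative, so its value at the singleton is the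
     probability of [A]. *)
  by rewrite /coverage -(rcs_ofP F).
rewrite EFinB fineK // /Vbar unlock /Valpha.
under eq_integral do rewrite AE EFinB.
rewrite integralB_EFin //.
- rewrite integral_indic // setIT integral_cst //; congr (_ - _)%E.
  (* The constant integrates to [alpha] because [P] has total mass one. *)
  by rewrite -[RHS]mule1; congr (_ * _)%E; exact: probability_setT.
- exact: integrable_indic.
- exact: finite_measure_integrable_cst.
Qed.

Theorem proposition5p3 (R : realType) (E : completeNormedModType R)
  (d : measure_display) (Omega : measurableType d) (P : probability Omega R)
  (sepE : separable E) (completeP : measure_is_complete P)
  (atomlessP : atomless P)
  (M : set (rcsDistribution P E)) (alpha : R) (alpha01 : 0 <= alpha <= 1) :
  strict_selective_identification M (Valpha alpha) (Qeq alpha) /\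
  (forall (u : E) (F : rcsDistribution P E), M F ->
    [/\ u \in Qgt alpha F -> (0 < Vbar (Valpha alpha) u F)%E,
        u \in Qeq alpha F -> Vbar (Valpha alpha) u F = 0%E &
        u \notin Qge alpha F -> (Vbar (Valpha alpha) u F < 0)%E]).
Proof.
(* This equivalence gives both strict identification and the middle case of the orientation. *)
have inE0 u F : Vbar (Valpha alpha) u F = 0%E <-> u \in Qeq alpha F.
  rewrite Vbar_Valpha inE /Qeq /=; split=> [[/eqP]|->]; last by rewrite subrr.
  by rewrite subr_eq0 => /eqP.
split=> u F _; first exact: inE0.
split; [|by move/inE0|]; rewrite Vbar_Valpha lte_fin.
- by rewrite inE subr_gt0.
- by rewrite subr_lt0 notin_setE /Qge /= => /negP; rewrite -ltNge.
Qed.
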